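(* The group $\mathbb{Z}_2\,\mathrm{wr}\,\mathbb{Z}^2$ contains distorted (finitely generated) subgroups; that is, there is a finitely generated subgroup $H$ of $\mathbb{Z}_2\,\mathrm{wr}\,\mathbb{Z}^2$ that is distorted.
   Context: $\mathbb{Z}_2=\mathbb{Z}/2\mathbb{Z}$ and $\mathrm{wr}$ denotes the restricted wreath product. For a group $G$ with finite generating set $T$ and an infinite subgroup $H$ with finite generating set $S$, the distortion function is $\Delta_H^G(l)=\max\{|w|_S : w\in H, |w|_T\le l\}$. For non-decreasing functions $f,g$ on the nonnegative integers, $f\preceq g$ means there is an integer $C>0$ with $f(l)\le Cg(Cl)$ for all $l\ge 0$; $f\approx g$ means $f\preceq g$ and $g\preceq f$. An infinite finitely generated subgroup $H$ is undistorted in $G$ if $\Delta_H^G(l)\approx l$, and distorted otherwise. *)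

(* Defs.v *)
From HB Require Import structures.
From mathcomp Require Import all_boot all_order all_algebra.
From mathcomp Require Import finmap.
From mathcomp Require Import boolp classical_sets cardinality.

Set Implicit Arguments.
Unset Strict Implicit.
Unset Printing Implicit Defensive.

Local Open Scope group_scope.
Local Open Scope classical_set_scope.

(* The restricted wreath product A wr B is the semidirect product of the      *)
(* finitely supported functions B -> A by B, where b acts on f by left        *)
(* translation: (b . f) x = f (b^-1 * x).                                     *)
Definition wreath (A B : groupType) : Type := ({fsfun B -> A with 1} * B)%type.

HB.instance Definition _ (A B : groupType) :=
  Choice.copy (wreath A B) ({fsfun B -> A with 1} * B)%type.

Section WreathGroup.
Context {A B : groupType}.
Implicit Types u v w : wreath A B.

Definition wreath_one : wreath A B := ([fsfun with 1], 1).

Definition wreath_mul u v : wreath A B :=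
  ([fsfun x in (finsupp u.1 `|` [fset (u.2 * y) | y in finsupp v.1])%fset
      => u.1 x * v.1 (u.2^-1 * x) | 1],
   u.2 * v.2).

Definition wreath_inv u : wreath A B :=
  ([fsfun x in [fset (u.2^-1 * y) | y in finsupp u.1]%fset
      => (u.1 (u.2 * x))^-1 | 1],
   u.2^-1).

Lemma wreath_mulE u v x :
  (wreath_mul u v).1 x = u.1 x * v.1 (u.2^-1 * x).
Proof.
rewrite /wreath_mul fsfunE in_fsetU; case: (boolP (_ || _)) => //.
rewrite negb_or => /andP[nu nv]; rewrite (fsfun_dflt nu) mul1g.
rewrite fsfun_dflt //; apply: contra nv => xv.
by apply/imfsetP; exists (u.2^-1 * x); rewrite ?mulVKg.
Qed.

Lemma wreath_invE u x : (wreath_inv u).1 x = (u.1 (u.2 * x))^-1.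
Proof.
rewrite /wreath_inv fsfunE; case: (boolP (x \in _)) => // nx.
rewrite fsfun_dflt ?invg1 //; apply: contra nx => xu.
by apply/imfsetP; exists (u.2 * x); rewrite ?mulKg.
Qed.

Lemma wreath_eqP u v : u.1 =1 v.1 -> u.2 = v.2 -> u = v.
Proof. by case: u v => [f a] [g b] /= /fsfunP-> ->. Qed.

Fact wreath_mulA : associative wreath_mul.
Proof.
move=> u v w; apply: wreath_eqP => [x|]; last exact: mulgA.
by rewrite !wreath_mulE /= mulgA invgM mulgA.
Qed.

Fact wreath_mul1 : left_id wreath_one wreath_mul.
Proof.
move=> u; apply: wreath_eqP => [x|]; last exact: mul1g.
by rewrite wreath_mulE fsfunE mul1g invg1 mul1g.
Qed.

Fact wreath_mulr1 : right_id wreath_one wreath_mul.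
Proof.
move=> u; apply: wreath_eqP => [x|]; last exact: mulg1.
by rewrite wreath_mulE fsfunE mulg1.
Qed.

Fact wreath_mulV : left_inverse wreath_one wreath_inv wreath_mul.
Proof.
move=> u; apply: wreath_eqP => [x|]; last exact: mulVg.
by rewrite wreath_mulE wreath_invE /= invgK mulVg fsfunE.
Qed.

Fact wreath_mulrV : right_inverse wreath_one wreath_inv wreath_mul.
Proof.
move=> u; apply: wreath_eqP => [x|]; last exact: mulgV.
by rewrite wreath_mulE wreath_invE mulVKg mulgV fsfunE.
Qed.

End WreathGroup.

HB.instance Definition _ (A B : groupType) := isGroup.Build (wreath A B)
  wreath_mulA wreath_mul1 wreath_mulr1 wreath_mulV wreath_mulrV.

(* The additive groups Z/2Z and Z^2, with their group law in multiplicative   *)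
(* notation.                                                                  *)
Definition cyclic2 : groupType := Algebra.to_multiplicative 'Z_2.
Definition lattice2 : groupType := Algebra.to_multiplicative (int * int)%type.

Section Distortion.
Context {G : groupType}.
Implicit Types S T H : set G.

Definition subgroup H : Prop :=
  H 1 /\ forall x y, H x -> H y -> H (x * y^-1).

Definition finite_generators S H : Prop :=
  finite_set S /\ smallest subgroup S = H.

Definition finitely_generated H : Prop := exists S, finite_generators S H.

(* Minimum and maximum of a set of natural numbers; the value is 0 when none  *)
(* exists.                                                                    *)
Definition nat_min (N : set nat) : nat := xget 0 (N `&` lbound N).
Definition nat_max (N : set nat) : nat := xget 0 (N `&` ubound N).

Definition is_word S (s : seq G) : Prop :=
  forall x, x \in s -> S x \/ S x^-1.

Definition word_length S (w : G) : nat :=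
  nat_min [set n | exists s : seq G,
    [/\ is_word S s, \prod_(x <- s) x = w & size s = n]].

(* S generates H and T generates G.                                           *)
Definition distortion T H S (l : nat) : nat :=
  nat_max [set word_length S w | w in [set w | H w /\ word_length T w <= l]].

End Distortion.

Definition dominated (f g : nat -> nat) : Prop :=
  exists C : nat, 0 < C /\ forall l, (f l <= C * g (C * l))%N.

Definition equivalent (f g : nat -> nat) : Prop :=
  dominated f g /\ dominated g f.

(* Changing the finite generating sets T and S does not change the class of   *)
(* the distortion function, so one choice with linear distortion suffices;    *)
(* being distorted then means nonlinear distortion for every choice.          *)
Definition undistorted (G : groupType) (H : set G) : Prop :=
  infinite_set H /\
  exists T S : set G,
    [/\ finite_generators T [set: G], finite_generators S H
      & equivalent (distortion T H S) (fun l => l)].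

Definition distorted (G : groupType) (H : set G) : Prop :=
  [/\ finitely_generated [set: G], finitely_generated H, infinite_set H
    & ~ undistorted H].

(* Main.v *)
(* Identify the base group of Z_2 wr Z^2 with the Laurent polynomial ring     *)
(* F_2[X^+-1, Y^+-1]. Multiplication by 1 + X on the base group extends to an *)
(* injective endomorphism phi of the wreath product, and the subgroup is the  *)
(* image of phi. The square with indicator                                    *)
(* (1 + X + ... + X^(n-1)) (1 + Y + ... + Y^(n-1)) has n^2 points, and every  *)
(* word over finitely many elements has support linear in its length, so its  *)
(* image under phi has length at least of order n^2 in the subgroup. But this *)
(* image, (1 + X^n) (1 + Y + ... + Y^(n-1)), consists of two columns at       *)
(* distance n, which a word of length O(n) in the whole group produces.       *)
Require Import Defs.
From HB Require Import structures.
From mathcomp Require Import all_boot all_order all_algebra.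
From mathcomp Require Import finmap zify.
From mathcomp Require Import boolp classical_sets cardinality.

Set Implicit Arguments.
Unset Strict Implicit.
Unset Printing Implicit Defensive.

Local Open Scope group_scope.
Local Open Scope classical_set_scope.

(** If [range phi] were undistorted, [undistorted_word_length] would bound its word length by [D]
    times the ambient one, for some choice of generating sets. The elements [phi (square n)]
    contradict this. By [phi_square] they are commutators of a column with a shift, so their ambient
    length is at most [C * n] ([word_length_phi_square]). As [phi] is injective ([twist_eq1]), a
    word in the subgroup lifts to a unique element, whose support is at most [K] times the word's
    length ([supp_size_phi_word]); for [square n] that support has at least [n * n] points. Hence
    [n * n <= K * D * C * n] for every [n], which is absurd. *)

Lemma nat_minP (N : set nat) n : N n -> N (nat_min N) /\ (nat_min N <= n)%N.
Proof.
move=> Nn; have exN : exists m, `[< N m >] by exists n; apply/asboolP.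
have [m /asboolP Nm minm] := ex_minnP exN.
have [Nmin lb] : (N `&` lbound N) (nat_min N).
  apply: xgetPex; exists m; split=> // k Nk.
  by rewrite leEnat; apply/minm/asboolP.
by split=> //; have := lb _ Nn; rewrite leEnat.
Qed.

(** The bound [m] guarantees a true maximum instead of the default 0. *)
Lemma leq_nat_max (N : set nat) n m : N n -> ubound N m -> (n <= nat_max N)%N.
Proof.
move=> Nn Nm; have exN : exists k, `[< N k >] by exists n; apply/asboolP.
have bN k : `[< N k >] -> (k <= m)%N.
  by move=> /asboolP /Nm; rewrite leEnat.
have [k /asboolP Nk maxk] := ex_maxnP exN bN.
have [_ ub] : (N `&` ubound N) (nat_max N).
  apply: xgetPex; exists k; split=> // l Nl.
  by rewrite leEnat; apply/maxk/asboolP.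
by have := ub _ Nn; rewrite leEnat.
Qed.

Lemma nat_max_unbounded (N : set nat) :
  (forall m, ~ ubound N m) -> nat_max N = 0.
Proof. by move=> Nm; apply: xgetPN => m [_ /Nm]. Qed.

(** * Words, word length and linear distortion *)

Section Words.
Variable G : groupType.
Implicit Types (S T H K : set G) (u v w : G) (s : seq G).

Lemma subgroupV H x : subgroup H -> H x -> H x^-1.
Proof. by move=> [H1 HM] Hx; rewrite -[x^-1]mul1g; apply: HM. Qed.

Lemma subgroupM H x y : subgroup H -> H x -> H y -> H (x * y).
Proof.
by move=> HH Hx Hy; rewrite -[y]invgK; apply: HH.2 => //; apply: subgroupV.
Qed.

Lemma subgroup_smallest S : subgroup (smallest subgroup S).
Proof.
split=> [K [[K1 _] _] //|x y Hx Hy K [KK SK]].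
by apply: KK.2; [apply: Hx | apply: Hy].
Qed.

Lemma is_word_cat S s t : is_word S s -> is_word S t -> is_word S (s ++ t).
Proof. by move=> Ss St x; rewrite mem_cat => /orP[/Ss|/St]. Qed.

Lemma is_word_rev S s : is_word S s -> is_word S (rev [seq x^-1 | x <- s]).
Proof.
move=> Ss x; rewrite mem_rev => /mapP[y /Ss Sy ->].
by rewrite invgK; case: Sy; [right|left].
Qed.

Lemma prod_revV s : \prod_(x <- rev [seq x^-1 | x <- s]) x = (\prod_(x <- s) x)^-1.
Proof.
elim: s => [|x s IHs]; first by rewrite !big_nil invg1.
by rewrite /= rev_cons -cats1 big_cat IHs big_seq1 big_cons invgM.
Qed.

(** The products of words form a subgroup containing [S], inverses being reversed words of inverse
    letters. *)
Lemma smallest_subgroup_word S w : smallest subgroup S w ->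
  exists2 s, is_word S s & \prod_(x <- s) x = w.
Proof.
apply: (smallest_sub (X := [set w | exists2 s, is_word S s & \prod_(x <- s) x = w])).
  split; first by exists [::]; rewrite ?big_nil.
  move=> _ _ [s Ss <-] [t St <-].
  exists (s ++ rev [seq x^-1 | x <- t]); last by rewrite big_cat prod_revV.
  exact/is_word_cat/is_word_rev.
by move=> x Sx; exists [:: x]; rewrite ?big_seq1 // => y; rewrite inE => /eqP->; left.
Qed.

Lemma word_lengthP S w : smallest subgroup S w ->
  exists s, [/\ is_word S s, \prod_(x <- s) x = w & size s = word_length S w].
Proof.
move=> /smallest_subgroup_word[s Ss sw].
by have [] := @nat_minP [set n | exists s : seq G,
  [/\ is_word S s, \prod_(x <- s) x = w & size s = n]] (size s); first by exists s.
Qed.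

Lemma word_length_prod S s :
  is_word S s -> (word_length S (\prod_(x <- s) x) <= size s)%N.
Proof. by move=> Ss; apply: (nat_minP _).2; exists s. Qed.

Lemma word_length1 S : word_length S 1 = 0.
Proof.
have := @word_length_prod S [::]; rewrite big_nil leqn0.
by move=> h; apply/eqP/h.
Qed.

Lemma word_lengthM S u v : smallest subgroup S u -> smallest subgroup S v ->
  (word_length S (u * v) <= word_length S u + word_length S v)%N.
Proof.
move=> /word_lengthP[s [Ss <- <-]] /word_lengthP[t [St <- <-]].
by rewrite -big_cat -size_cat; apply/word_length_prod/is_word_cat.
Qed.

Lemma word_lengthV S u : smallest subgroup S u ->
  (word_length S u^-1 <= word_length S u)%N.
Proof.
move=> /word_lengthP[s [Ss <- <-]]; rewrite -prod_revV.
rewrite -[leqRHS](size_map (fun x : G => x^-1)) -size_rev.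
by apply/word_length_prod/is_word_rev.
Qed.

Lemma word_lengthX S u n : smallest subgroup S u ->
  (word_length S (u ^+ n) <= n * word_length S u)%N.
Proof.
move=> Su; have SX m : smallest subgroup S (u ^+ m).
  elim: m => [|m IHm]; first by case: (subgroup_smallest S).
  by rewrite expgS; apply: (subgroupM (subgroup_smallest S)).
elim: n => [|n IHn]; first by rewrite word_length1.
by rewrite expgS mulSn (leq_trans (word_lengthM _ _)) ?leq_add2l.
Qed.

(* The lower half of the equivalence only serves to exclude the junk value 0  *)
(* of [nat_max] on unbounded sets.                                            *)
Lemma undistorted_word_length T S H :
  equivalent (distortion T H S) (fun l => l) ->
  exists D, forall w, H w -> (word_length S w <= D * word_length T w)%N.
Proof.
move=> [[D [_ leD]] [E [E0 geE]]]; exists (D * D)%N => w Hw.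
rewrite -mulnA; apply: leq_trans (leD _).
set l := word_length T w.
have [[m ubm]|unb] := pselect (exists m,
    ubound [set word_length S w | w in [set w | H w /\ (word_length T w <= l)%N]] m).
  by apply: leq_nat_max ubm; exists w.
(* Unboundedness at radius [l] persists at [E * l.+1], where the distortion is then 0; taking [l.+1]
   makes the left side positive even for [l = 0]. *)
have := geE l.+1; rewrite [X in (_ * X)%N]nat_max_unbounded ?muln0 // => m ubm.
apply: unb; exists m => _ [v [Hv vl] <-]; apply: ubm; exists v => //; split=> //.
by rewrite (leq_trans vl)// (leq_trans (leqnSn _))// leq_pmull.
Qed.

End Words.

Lemma finite_generators_image (G K : groupType) (f : UMagmaMorphism.type G K)
    (S : set G) :
  finite_generators S [set: G] -> finite_generators (f @` S) (range f).
Proof.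
move=> [finS SG]; split; first exact: finite_image.
set H := smallest _ _; have HH : subgroup H by apply: subgroup_smallest.
apply/seteqP; split.
  apply: smallest_sub; last by move=> _ [u _ <-]; exists u.
  split=> [|_ _ [u _ <-] [w _ <-]]; first by exists 1; rewrite ?gmulf1.
  by exists (u / w); rewrite ?gmulfF.
move=> _ [u _ <-]; have : smallest subgroup S u by rewrite SG.
apply: (smallest_sub (X := [set u | H (f u)])).
  split=> [|w z Hw Hz] /=; first by rewrite gmulf1; apply: HH.1.
  by rewrite gmulfF; apply: HH.2.
by move=> w Sw; apply: sub_gen_smallest; exists w.
Qed.

(** * Supports, generation and the twist map in a wreath product *)

Section Wreath.
Variables A B : groupType.
Implicit Types (u v : wreath A B) (t : A) (b c p : B).

Lemma mulwE u v p : (u * v).1 p = u.1 p * v.1 (u.2^-1 * p).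
Proof. exact: wreath_mulE. Qed.

Lemma mulw2 u v : (u * v).2 = u.2 * v.2.
Proof. by []. Qed.

Lemma invwE u p : u^-1.1 p = (u.1 (u.2 * p))^-1.
Proof. exact: wreath_invE. Qed.

Lemma invw2 u : u^-1.2 = u.2^-1.
Proof. by []. Qed.

Lemma onewE p : (1 : wreath A B).1 p = 1.
Proof. by rewrite fsfunE. Qed.

Lemma expw2 u n : (u ^+ n).2 = u.2 ^+ n.
Proof. by elim: n => // n IHn; rewrite !expgS mulw2 IHn. Qed.

Definition supp_size u : nat := #|` finsupp u.1|.

Lemma supp_size1 : supp_size 1 = 0.
Proof. by rewrite /supp_size finsupp0 cardfs0. Qed.

(** The support of [u * v] lies in the support of [u] together with a translate of that of [v]. *)
Lemma supp_sizeM u v : (supp_size (u * v)%g <= supp_size u + supp_size v)%N.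
Proof.
pose W := (finsupp u.1 `|` [fset (u.2 * p) | p in finsupp v.1])%fset.
apply: (@leq_trans #|` W|).
  apply/fsubset_leq_card/fsubsetP => p; rewrite mem_finsupp mulwE in_fsetU.
  apply: contraR; rewrite negb_or => /andP[/fsfun_dflt -> pv].
  rewrite mul1g fsfun_dflt //; apply: contra pv => pv.
  by apply/imfsetP; exists (u.2^-1 * p); rewrite ?mulVKg.
rewrite (leq_trans (leq_card_fsetU _ _)) // leq_add2l.
exact: leq_imfset_card.
Qed.

Lemma supp_sizeV u : (supp_size u^-1 <= supp_size u)%N.
Proof.
apply: (@leq_trans #|` [fset (u.2^-1 * p) | p in finsupp u.1]%fset|); last first.
  exact: leq_imfset_card.
apply/fsubset_leq_card/fsubsetP => p; rewrite mem_finsupp invwE => pu.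
apply/imfsetP; exists (u.2 * p); rewrite ?mulKg // mem_finsupp.
by apply: contra pu => /eqP->; rewrite invg1.
Qed.

Definition base (f : {fsfun B -> A with 1}) : wreath A B := (f, 1).
Definition lamp t p : wreath A B := base [fsfun x in [fset p]%fset => t | 1].
Definition shift b : wreath A B := ([fsfun with 1], b).

Lemma lampE t p q : (lamp t p).1 q = if q == p then t else 1.
Proof. by rewrite fsfunE inE. Qed.

Lemma shiftE b p : (shift b).1 p = 1.
Proof. by rewrite fsfunE. Qed.

Lemma shiftM b c : shift (b * c) = shift b * shift c.
Proof. by apply: wreath_eqP => // p; rewrite mulwE !shiftE mulg1. Qed.

Lemma shiftX b n : shift (b ^+ n) = shift b ^+ n.
Proof. by elim: n => // n IHn; rewrite !expgS shiftM IHn. Qed.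

Lemma shiftV b : shift b^-1 = (shift b)^-1.
Proof. by apply: wreath_eqP => // p; rewrite invwE !shiftE invg1. Qed.

Lemma lamp_conj t p : lamp t p = shift p * lamp t 1 * (shift p)^-1.
Proof.
apply: wreath_eqP => [q|]; last by rewrite !mulw2 mulg1 mulgV.
rewrite !mulwE invwE !shiftE mul1g invg1 mulg1 !lampE /=.
by rewrite -[p^-1 * q == 1](inj_eq (mulgI p)) mulVKg mulg1.
Qed.

(** Conjugating by shifts moves a lamp from 1 to any position; a base element is then a product of
    lamps, by induction on its support. *)
Lemma subgroup_wreath (K : set (wreath A B)) : subgroup K ->
  (forall t, K (lamp t 1)) -> (forall b, K (shift b)) -> K = [set: wreath A B].
Proof.
move=> KK Kl Ks; apply/seteqP; split=> // u _.
have KM := subgroupM KK.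
have Klp t p : K (lamp t p).
  by rewrite lamp_conj; apply: KK.2 => //; apply: KM.
have -> : u = base u.1 * shift u.2.
  by apply: wreath_eqP => [p|]; rewrite ?mulwE ?shiftE ?mulg1 // mulw2 mul1g.
apply: (KM) => //; move: (u.1) => f {u}.
have [n] := ubnP #|` finsupp f|; elim: n f => // n IHn f.
rewrite ltnS => fn; have [f0|[p pf]] := fset_0Vmem (finsupp f).
  have -> : base f = 1.
    apply: wreath_eqP => // p; rewrite onewE fsfun_dflt //.
    by rewrite f0 inE.
  exact: KK.1.
(* This is [f] with its value at [p] reset to 1. *)
pose g := (lamp (f p)^-1 p * base f).1.
have -> : base f = lamp (f p) p * base g.
  apply: wreath_eqP => [q|]; last by rewrite mulw2 mulg1.
  rewrite mulwE /g mulwE !lampE /= !invg1 !mul1g.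
  by case: eqP => [->|_]; rewrite ?mulVg ?mulg1 ?mul1g.
apply: (KM) => //; apply: IHn; apply: leq_trans fn.
rewrite [leqRHS](cardfsD1 p) pf ltnS; apply/fsubset_leq_card/fsubsetP => q.
rewrite !inE mem_finsupp /g mulwE lampE /= invg1 mul1g mem_finsupp.
by case: (q =P p) => [->|_]; rewrite ?mulVg ?eqxx ?mul1g.
Qed.

(* With A written additively, u = (f, b) is sent to ((1 + c) f, b).           *)
Definition twist c u : wreath A B := ((base u.1 * shift c * base u.1).1, u.2).

Lemma twistE c u p : (twist c u).1 p = u.1 p * u.1 (c^-1 * p).
Proof. by rewrite !mulwE shiftE mulg1 mulw2 mul1g. Qed.

(** Commutativity of [A] makes multiplication by 1 + c additive on the base; centrality of [c] makes
    it commute with the action of [B]. *)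
Lemma twistM c u v : (forall s t : A, commute s t) -> (forall b, commute c b) ->
  twist c (u * v) = twist c u * twist c v.
Proof.
move=> cA cB; apply: wreath_eqP => // p.
rewrite [RHS]mulwE !twistE !mulwE /=.
have -> : u.2^-1 * (c^-1 * p) = c^-1 * (u.2^-1 * p).
  by rewrite !mulgA -!invgM cB.
by rewrite -!mulgA; congr (_ * _); rewrite !mulgA (cA (v.1 _)).
Qed.

(** If 1 + c kills [u.1], its support is stable under translation by [c^-1]. As [c] has infinite
    order, a nonempty support would be infinite. *)
Lemma twist_eq1 c u : injective (fun n => c ^+ n) -> twist c u = 1 -> u = 1.
Proof.
move=> c_inf u1; apply: wreath_eqP; last by have := congr1 snd u1.
move=> p; rewrite onewE; apply/eqP/negP => up.
have step q : u.1 q != 1 -> u.1 (c^-1 * q) != 1.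
  have : (twist c u).1 q = 1 by rewrite u1 onewE.
  by rewrite twistE => /mulg1_eq <-; rewrite invg_eq1.
have orb n : u.1 (c^-1 ^+ n * p) != 1.
  elim: n => [|n IHn]; first by rewrite mul1g; apply/negP.
  by rewrite expgS -mulgA step.
pose s := [seq c^-1 ^+ n * p | n <- iota 0 (supp_size u).+1].
have : (size s <= supp_size u)%N.
  apply: uniq_leq_size; last first.
    by move=> _ /mapP[n _ ->]; rewrite mem_finsupp orb.
  rewrite map_inj_uniq ?iota_uniq // => m n /mulIg.
  by rewrite !expVgn => /invg_inj /c_inf.
by rewrite size_map size_iota ltnn.
Qed.

End Wreath.

Arguments shift {A B} b.

(** * The group Z_2 wr Z^2 and its generators *)

Section Cyclic2Lattice2.
Local Notation G := (wreath cyclic2 lattice2).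
Implicit Types (i j : int) (m n : nat).

Definition z1 : cyclic2 := (1 : 'Z_2)%R.
Definition e1 : lattice2 := (1, 0)%R.
Definition e2 : lattice2 := (0, 1)%R.
Definition ga : G := lamp z1 1.
Definition gx : G := shift e1.
Definition gy : G := shift e2.

Lemma cyclic2C (s t : cyclic2) : commute s t.
Proof. exact: GRing.addrC. Qed.

Lemma lattice2C (p q : lattice2) : commute p q.
Proof. exact: GRing.addrC. Qed.

Lemma cyclic2_sqr (t : cyclic2) : t * t = 1.
Proof. by apply/eqP; case: t => -[|[|]]. Qed.

Lemma lattice2E i j i' j' :
  ((i, j) : lattice2) * ((i', j') : lattice2) = (i + i', j + j')%R.
Proof. by []. Qed.

Lemma lattice2VE i j : ((i, j) : lattice2)^-1 = (- i, - j)%R.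
Proof. by []. Qed.

Lemma e1X n : e1 ^+ n = (n%:Z, 0)%R.
Proof.
elim: n => // n IHn; rewrite expgS IHn lattice2E; congr (_, _); lia.
Qed.

Lemma e2X n : e2 ^+ n = (0, n%:Z)%R.
Proof.
elim: n => // n IHn; rewrite expgS IHn lattice2E; congr (_, _); lia.
Qed.

Lemma subgroup_lattice2 (K : set lattice2) :
  subgroup K -> K e1 -> K e2 -> forall p, K p.
Proof.
move=> KK K1 K2 [i j].
have KX p n : K p -> K (p ^+ n).
  move=> Kp; elim: n => [|n IHn]; first exact: KK.1.
  by rewrite expgS; apply: subgroupM.
have Ki : K (i, 0%R).
  case: (intP i) => [|n|n]; first exact: KK.1.
    by rewrite -e1X; apply: KX.
  have := subgroupV KK (KX _ n.+1 K1).
  by rewrite e1X lattice2VE.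
have Kj : K (0%R, j).
  case: (intP j) => [|n|n]; first exact: KK.1.
    by rewrite -e2X; apply: KX.
  have := subgroupV KK (KX _ n.+1 K2).
  by rewrite e2X lattice2VE.
have -> : (i, j) = ((i, 0%R) : lattice2) * ((0%R, j) : lattice2).
  by rewrite lattice2E GRing.addr0 GRing.add0r.
exact: subgroupM.
Qed.

Lemma subgroup_eq_setT (K : set G) :
  subgroup K -> K ga -> K gx -> K gy -> K = [set: G].
Proof.
move=> KK Ka Kx Ky; apply: subgroup_wreath => // [t|b].
  have [->|->] : t = z1 \/ t = 1.
    by case: t => -[|[|//]] ?; [right|left]; apply: val_inj.
    by [].
  have -> : lamp 1 1 = 1 :> G.
    by apply: wreath_eqP => // p; rewrite lampE onewE if_same.
  exact: KK.1.
apply: (@subgroup_lattice2 [set b | K (shift b)]) => //; split=> [|p q Kp Kq].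
  exact: KK.1.
by rewrite /= shiftM shiftV; apply: KK.2.
Qed.

(** * The endomorphism [phi], multiplication by 1 + X *)

Definition phi (u : G) : G := twist e1 u.

Lemma phiM u w : phi (u * w) = phi u * phi w.
Proof. exact: (twistM _ _ cyclic2C (lattice2C e1)). Qed.

Lemma phi1 : phi 1 = 1.
Proof. by apply: (mulIg (phi 1)); rewrite -phiM !mul1g. Qed.

HB.instance Definition _ := isUMagmaMorphism.Build G G phi (phi1, phiM).

Lemma phi_inj : injective phi.
Proof.
apply: gmulf_inj => u; apply: twist_eq1 => m n.
by rewrite !e1X => -[].
Qed.

Lemma phi_shift b : phi (shift b) = shift b.
Proof. by apply: wreath_eqP => // p; rewrite twistE !shiftE mulg1. Qed.

(** The base elements 1 + Y + ... + Y^(n-1) and its product with 1 + X + ... + X^(n-1). Each is made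
    by repeatedly switching lamps and stepping, then walking back to the origin. *)
Definition column n : G := (ga * gy) ^+ n * gy ^- n.
Definition square n : G := (column n * gx) ^+ n * gx ^- n.

Lemma column2 n : (column n).2 = 1.
Proof. by rewrite mulw2 invw2 !expw2 mulw2 mul1g mulgV. Qed.

Lemma columnE n i j :
  (column n).1 (i, j) = if (i == 0%R) && (0 <= j < n%:Z)%R then z1 else 1.
Proof.
rewrite mulwE expw2 mulw2 mul1g -shiftX invwE shiftE invg1 mulg1.
elim: n => [|n IHn]; first by rewrite onewE; case: ifP => //; lia.
(* The last factor switches the lamp at [(0, n)], which the first [n] factors leave off. *)
rewrite expgSr mulwE IHn expw2 mulw2 mul1g e2X lattice2VE lattice2E.
rewrite mulwE shiftE mulg1 lampE /=.
have -> : ((- 0 + i, - n%:Z + j)%R == 1 :> lattice2) = (i == 0%R) && (j == n%:Z)%R.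
  rewrite [LHS]xpair_eqE; lia.
do 3?[case: ifP] => //; rewrite ?mulg1 ?mul1g //; lia.
Qed.

Lemma squareE n i j :
  (square n).1 (i, j) =
    if (0 <= i < n%:Z)%R && (0 <= j < n%:Z)%R then z1 else 1.
Proof.
rewrite mulwE -shiftX invwE shiftE invg1 mulg1.
suff hm m : ((column n * gx) ^+ m).1 (i, j) =
    if (0 <= i < m%:Z)%R && (0 <= j < n%:Z)%R then z1 else 1 by [].
elim: m => [|m IHm]; first by rewrite onewE; case: ifP => //; lia.
rewrite expgSr mulwE IHm expw2 mulw2 column2 mul1g e1X lattice2VE lattice2E.
rewrite mulwE shiftE mulg1 columnE.
do 3?[case: ifP] => //; rewrite ?mulg1 ?mul1g //; lia.
Qed.

Lemma supp_size_square n : (n * n <= supp_size (square n))%N.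
Proof.
pose s := [seq ((i%:Z, j%:Z)%R : lattice2) | i : nat <- iota 0 n, j : nat <- iota 0 n].
have -> : (n * n)%N = size s by rewrite size_allpairs !size_iota.
apply: uniq_leq_size.
  by apply: allpairs_uniq; rewrite ?iota_uniq // => -[i j] [k l] _ _ [-> ->].
move=> _ /allpairsP[[i j] /= [im jm ->]]; rewrite mem_finsupp squareE.
by rewrite !mem_iota in im jm; case: ifP => //; lia.
Qed.

Lemma phi_column n : phi (column n) = column n * gx * column n * gx^-1.
Proof.
apply: wreath_eqP => [p|]; last first.
  by rewrite [LHS]column2 3!mulw2 column2 invw2 mulg1 mul1g mulgV.
rewrite [LHS]twistE [RHS]mulwE invwE !shiftE invg1 mulg1 2![in RHS]mulwE shiftE.
by rewrite mulg1 mulw2 column2 mul1g.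
Qed.

(** In the base this is (1 + X)(1 + ... + X^(n-1)) = 1 + X^n, applied to a column. The commutator
    form displays a word of length linear in [n]. *)
Lemma phi_square n : phi (square n) = column n * gx ^+ n * (column n)^-1 * gx ^- n.
Proof.
have columnV : column n = (column n)^-1.
  apply: wreath_eqP => [p|]; last by rewrite invw2 column2 invg1.
  by rewrite invwE column2 mul1g; apply/esym/mulg1_eq/cyclic2_sqr.
(* As column n is an involution, (column n * gx * column n) ^+ n is a conjugate
   of gx ^+ n: this is the telescoping of (1 + e1) times the square. *)
have conjX : column n * gx ^+ n * (column n)^-1 = (column n * gx * (column n)^-1) ^+ n.
  by have := conjXg gx (column n)^-1 n; rewrite /conjg invgK !mulgA.
rewrite conjX -columnV /square gmulfM gmulfXn gmulfM /= -shiftX.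
rewrite -shiftV !phi_shift phi_column.
by rewrite mulgVK.
Qed.

(** * Distortion of the image of [phi] *)

Lemma finite_generators_G : finite_generators [set ga; gx; gy] [set: G].
Proof.
split; first by rewrite !finite_setU; do !split; apply: finite_set1.
have SG := @sub_gen_smallest _ subgroup [set ga; gx; gy].
apply: subgroup_eq_setT; first exact: subgroup_smallest.
- by apply: SG; left; left.
- by apply: SG; left; right.
- by apply: SG; right.
Qed.

(** Shifts are fixed by [phi], so the image contains all powers of [gx]. *)
Lemma infinite_range_phi : infinite_set (range phi).
Proof.
move=> /(finite_image (fun u : G => `|u.2.1|%N)) fin; apply: infinite_nat.
apply: sub_finite_set fin => n _; exists (shift (e1 ^+ n)); last by rewrite /= e1X.
by exists (shift (e1 ^+ n)); rewrite ?phi_shift.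
Qed.

(** Each letter is lifted through [phi]; [K] is the largest support among the finitely many
    preimages of generators, and supports are subadditive. This gives the lower bound on length in
    the subgroup. *)
Lemma supp_size_phi_word S : finite_set S -> S `<=` range phi ->
  exists K, forall s, is_word S s ->
    exists2 u, phi u = \prod_(g <- s) g & (supp_size u <= K * size s)%N.
Proof.
move=> finS Sphi; have : finite_set (phi @^-1` S).
  by apply: finite_preimage => // u w _ _; apply: phi_inj.
move=> /finite_seqP[r Sr]; pose K := \max_(u <- r) supp_size u.
have leK u : S (phi u) -> (supp_size u <= K)%N.
  move=> Su; have ur : u \in r by have : (phi @^-1` S) u by []; rewrite Sr.
  exact: (leq_bigmax_seq u ur).
have letter g : S g \/ S g^-1 -> exists2 u, phi u = g & (supp_size u <= K)%N.
  case=> Sg; have [u _ ug] := Sphi _ Sg.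
    by exists u => //; apply: leK; rewrite ug.
  exists u^-1; first by rewrite gmulfV /= ug invgK.
  by rewrite (leq_trans (supp_sizeV u)) // leK // ug.
exists K; elim=> [|g s IHs] Ss.
  by exists 1; rewrite ?supp_size1 // big_nil gmulf1.
have [u ug uK] : exists2 u, phi u = g & (supp_size u <= K)%N.
  by apply/letter/Ss; rewrite inE eqxx.
have [w ws wK] : exists2 w, phi w = \prod_(g <- s) g & (supp_size w <= K * size s)%N.
  by apply: IHs => z zs; apply: Ss; rewrite inE zs orbT.
exists (u * w); first by rewrite big_cons gmulfM /= ug ws.
by rewrite (leq_trans (supp_sizeM u w)) //= mulnS leq_add.
Qed.

Lemma word_length_phi_square T : smallest subgroup T = [set: G] ->
  exists C, forall n, (word_length T (phi (square n)) <= C * n)%N.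
Proof.
move=> TG; pose L := word_length T.
have LM u w : (L (u * w)%g <= L u + L w)%N by apply: word_lengthM; rewrite TG.
have LV u : (L u^-1 <= L u)%N by apply: word_lengthV; rewrite TG.
have LX u n : (L (u ^+ n) <= n * L u)%N by apply: word_lengthX; rewrite TG.
(* The factor 2 counts the two columns and the two powers of [gx] in the commutator. *)
exists (2 * (L (ga * gy)%g + L gy + L gx))%N => n; rewrite -/(L _) phi_square.
have Lcol : (L (column n) <= n * L (ga * gy)%g + n * L gy)%N.
  by rewrite (leq_trans (LM _ _)) // leq_add // (leq_trans (LV _)).
have := LM (column n * gx ^+ n / column n) (gx ^- n).
have := LM (column n * gx ^+ n) (column n)^-1.
have := LM (column n) (gx ^+ n); have := LV (column n); have := LV (gx ^+ n).
have := LX gx n; move: Lcol.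
by do 10 move: (L _) => ?; nia.
Qed.

Lemma range_phi_not_undistorted : ~ undistorted (range phi).
Proof.
move=> [_ [T [S [[_ TG] [finS SH] /undistorted_word_length[D leD]]]]].
have Sphi : S `<=` range phi by rewrite -SH; apply: sub_gen_smallest.
have [K lift] := supp_size_phi_word finS Sphi.
have [C leC] := word_length_phi_square TG.
have quad n : (n * n <= K * (D * (C * n)))%N.
  have phi_hn : range phi (phi (square n)) by exists (square n).
  have [s [Ss sh size_s]] := @word_lengthP _ S (phi (square n)) ltac:(by rewrite SH).
  have [u us uK] := lift s Ss.
  move: us; rewrite sh => /phi_inj uh; rewrite {}uh size_s in uK.
  rewrite (leq_trans (supp_size_square n)) // (leq_trans uK) // leq_mul2l.
  by rewrite (leq_trans (leD _ phi_hn)) ?orbT // leq_mul2l leC orbT.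
(* Cancelling one factor [n] leaves [n <= K * D * C], which fails for its successor. *)
by have := quad (K * D * C).+1; rewrite !mulnA leq_pmul2r // ltnn.
Qed.

End Cyclic2Lattice2.

Theorem proposition4p1 :
  exists H : set (wreath cyclic2 lattice2), finitely_generated H /\ distorted H.
Proof.
have fgH := finite_generators_image phi finite_generators_G.
exists (range phi); split; first by eexists; exact: fgH.
split; [by eexists; exact: finite_generators_G | by eexists; exact: fgH | |].
- exact: infinite_range_phi.
- exact: range_phi_not_undistorted.
Qed.
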